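(* Let $t\geq 9$ be an integer and $\mathcal{H}=\mathrm{Forb}(K_{2,t})$. There exists a value $q_0$ such that for every prime power $q>q_0$ for which $t-1$ divides $q-1$ there is a $p_q\in(0,1)$ with $$\frac{t-1+p_q\left(2q^2-q(t-1)-2t\right)}{2(q^2-1)}<p_q(1-p_q),$$ and these $p_q$ can be chosen so that $p_q\to 0$ as $q\to\infty$. That is, arbitrarily close to $p=0$ there is some value $p>0$ such that $\mathrm{ed}_{\mathcal{H}}(p)<p(1-p)$.
   Context: All graphs are finite and simple. $K_{2,t}$ is the complete bipartite graph with parts of sizes $2$ and $t$. For a graph $H$, $\mathrm{Forb}(H)$ is the hereditary property consisting of all graphs with no induced subgraph isomorphic to $H$. For graphs $G,G'$ on the same labeled vertex set, $\mathrm{dist}(G,G')=|E(G)\,\Delta\, E(G')|$; for a hereditary property $\mathcal{H}$ (a set of graphs closed under isomorphism and vertex deletion), $\mathrm{dist}(G,\mathcal{H})=\min\{\mathrm{dist}(G,G'): G'\in\mathcal{H},\ V(G')=V(G)\}$. The edit distance function is $$\mathrm{ed}_{\mathcal{H}}(p)=\lim_{n\to\infty}\max\left\{\mathrm{dist}(G,\mathcal{H}): |V(G)|=n,\ |E(G)|=\left\lfloor p\tbinom n2\right\rfloor\right\}\Big/\tbinom n2,\qquad p\in[0,1].$$ (The limit is known to exist, and the function is known to be continuous and concave.) *)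

(* Defs.v *)
From HB Require Import structures.
From mathcomp Require Import all_boot all_order all_algebra.
From mathcomp Require Import boolp classical_sets reals topology normedtype sequences.

Set Implicit Arguments.
Unset Strict Implicit.
Unset Printing Implicit Defensive.

Import Order.TTheory GRing.Theory Num.Theory.
Import numFieldNormedType.Exports.

Local Open Scope ring_scope.

(** A simple graph on [V] is its edge set, a set of 2-element subsets of [V]. *)
Definition simple_graph (V : finType) : Type :=
  {E : {set {set V}} | [forall e in E, #|e| == 2%N]}.

Definition mk_simple_graph (V : finType) (E : {set {set V}})
    (hE : [forall e in E, #|e| == 2%N]) : simple_graph V :=
  exist (fun E : {set {set V}} => [forall e in E, #|e| == 2%N]) E hE.

Definition edges (V : finType) (G : simple_graph V) : {set {set V}} := val G.

(** Irreflexive, because [[set u; u]] is a singleton. *)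
Definition adj (V : finType) (G : simple_graph V) (u v : V) : bool :=
  [set u; v] \in edges G.

Definition isomorphic (V W : finType) (G : simple_graph V) (H : simple_graph W)
    : Prop :=
  exists2 f : V -> W, bijective f & forall u v, adj H (f u) (f v) = adj G u v.

Lemma induced_subproof (V : finType) (G : simple_graph V) (S : {set V}) :
  [forall e in [set e : {set {x : V | x \in S}} | [set val x | x in e] \in edges G],
     #|e| == 2%N].
Proof.
apply/forall_inP => e; rewrite inE => eG.
by rewrite -(card_imset _ val_inj); apply: (forall_inP (valP G)).
Qed.

Definition induced (V : finType) (G : simple_graph V) (S : {set V}) :
    simple_graph {x : V | x \in S} :=
  mk_simple_graph (induced_subproof G S).

Lemma complete_bipartite_subproof (m n : nat) :
  [forall e in [set [set (inl i : 'I_m + 'I_n); inr j] | i : 'I_m, j : 'I_n],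
     #|e| == 2%N].
Proof. by apply/forall_inP => _ /imset2P[i j _ _ ->]; rewrite cards2. Qed.

Definition complete_bipartite (m n : nat) : simple_graph ('I_m + 'I_n)%type :=
  mk_simple_graph (complete_bipartite_subproof m n).

Definition graph_property : Type := forall V : finType, simple_graph V -> Prop.

Definition Forb (W : finType) (H : simple_graph W) : graph_property :=
  fun V G => ~ exists S : {set V}, isomorphic (induced G S) H.

Definition dist (V : finType) (G G' : simple_graph V) : nat :=
  #|(edges G :\: edges G') :|: (edges G' :\: edges G)|.

(** No distance exceeds ['C(#|V|, 2)], so this is the true minimum as soon as
    some graph on [V] satisfies [P]; for [Forb H] the edgeless or the complete
    graph on [V] does, provided that [H] has at least two vertices. *)
Definition dist_to (P : graph_property) (V : finType) (G : simple_graph V) : nat :=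
  \big[minn/'C(#|V|, 2)]_(G' : simple_graph V | `[< P V G' >]) dist G G'.

(** The maximum is over a nonempty set when [0 <= p <= 1]. *)
Definition max_dist (R : realType) (P : graph_property) (p : R) (n : nat) : nat :=
  \max_(G : simple_graph 'I_n
        | (#|edges G|%:Z == Num.floor (p * 'C(n, 2)%:R))) dist_to P G.

(** Meaningful for [P] hereditary and [0 <= p <= 1], where the limit exists. *)
Definition edit_distance (R : realType) (P : graph_property) (p : R) : R :=
  limn (fun n : nat => (max_dist P p n)%:R / 'C(n, 2)%:R : R).

Definition prime_power (q : nat) : Prop :=
  exists r k : nat, [/\ prime r, (0 < k)%N & q = (r ^ k)%N].

(* Main.v *)
Require Import Defs.
From HB Require Import structures.
From mathcomp Require Import all_boot all_order all_algebra.
From mathcomp Require Import boolp classical_sets reals topology normedtype sequences.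
From mathcomp Require Import cyclic finfield lra ring.

Set Implicit Arguments.
Unset Strict Implicit.
Unset Printing Implicit Defensive.

Import Order.TTheory GRing.Theory Num.Theory.
Import numFieldNormedType.Exports.

(** Let F be the field with q elements, s = t - 1, and H the group of s-th roots
    of unity in F.  The gray graph is the bipartite double of Füredi's
    K_{2,t}-free graph: its vertices are two copies of the H-orbits of nonzero
    vectors of F^2, and the orbits of a and c, in different copies, are joined
    when the dot product of a and c lies in H.  Map the vertices of a graph G to
    these (q^2 - 1) * 2 / s classes at random, make every class a clique, keep G
    between joined classes and delete all other edges.  In an induced K_{2,t} of
    the result the two vertices of the small side lie in different classes, and
    so do the t vertices of the large side.  If the former lie in the same copy,
    the t classes of the latter are joined to both, and dividing the two dot
    products embeds them into H; if not, three of the t vertices already give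
    a contradiction.  The expected number of edits gives the bound on the edit
    distance function, and p_q = s (q + 2) / (4 (q^2 - 1)) optimises the
    comparison with p (1 - p).  Powers of a prime r > s with exponent divisible
    by the totient of s are prime powers that are 1 modulo s. *)

Local Open Scope nat_scope.

(** * Recoloring a graph along a map to a colored regularity graph *)

Lemma set2_eq_cases (V : finType) (u v u' v' : V) :
  [set u; v] = [set u'; v'] -> (u = u' /\ v = v') \/ (u = v' /\ v = u').
Proof.
move=> /setP E.
move: (E u) (E v) (E u') (E v'); rewrite !inE !eqxx ?orbT /=.
move=> /esym /orP[]/eqP-> /esym /orP[]/eqP->; rewrite ?orbb; auto.
  by move=> _ /eqP->; auto.
by move=> /eqP->; auto.
Qed.

(** [B] and [Y] are the black (or equal) and gray pairs of a colored regularity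
    graph on [X]; all other pairs are white. *)
Definition recolor_edges (V X : finType) (B Y : rel X) (G : simple_graph V)
    (f : V -> X) : {set {set V}} :=
  [set e : {set V} | [exists u, exists v, [&& u != v, e == [set u; v] &
     B (f u) (f v) || Y (f u) (f v) && (e \in edges G)]]].

Lemma recolor_subproof (V X : finType) (B Y : rel X) (G : simple_graph V)
    (f : V -> X) :
  [forall e in recolor_edges B Y G f, #|e| == 2].
Proof.
apply/forall_inP => e; rewrite inE => /existsP[u /existsP[v /and3P[uv /eqP-> _]]].
by rewrite cards2 uv.
Qed.

Definition recolor (V X : finType) (B Y : rel X) (G : simple_graph V)
    (f : V -> X) : simple_graph V :=
  mk_simple_graph (recolor_subproof B Y G f).

Lemma adj_recolor (V X : finType) (B Y : rel X) (G : simple_graph V)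
    (f : V -> X) (u v : V) : symmetric B -> symmetric Y ->
  adj (recolor B Y G f) u v =
    (u != v) && (B (f u) (f v) || Y (f u) (f v) && adj G u v).
Proof.
move=> symB symY; rewrite /adj inE; apply/existsP/andP => [|[uv H]]; last first.
  by exists u; apply/existsP; exists v; rewrite uv eqxx.
move=> [u' /existsP[v' /and3P[uv /eqP]]] /set2_eq_cases[] [-> ->]; first by rewrite uv.
by rewrite eq_sym uv symB symY finset.setUC.
Qed.

(** Excludes what an induced K_{2,t} of a recolored graph would leave in [X]: a black pair forces an
    edge, so no pair inside a side is black, and a white pair forbids one, so no pair across the
    sides is white. *)
Definition free_of_K2t (X : finType) (B Y : rel X) (t : nat) : Prop :=
  forall (x x' : X) (y : 'I_t -> X), ~~ B x x' ->
    (forall i j, i != j -> ~~ B (y i) (y j)) ->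
    (forall j, B x (y j) || Y x (y j)) ->
    (forall j, B x' (y j) || Y x' (y j)) -> False.

Lemma adj_induced (V : finType) (G : simple_graph V) (S : {set V})
    (u v : {x : V | x \in S}) :
  adj (induced G S) u v = adj G (val u) (val v).
Proof. by rewrite /adj inE imsetU !imset_set1. Qed.

Lemma adj_complete_bipartite (m n : nat) (u v : 'I_m + 'I_n) :
  adj (complete_bipartite m n) u v =
    match u, v with inl _, inr _ | inr _, inl _ => true | _, _ => false end.
Proof.
rewrite /adj; case: u v => [i|i] [j|j].
- by apply/imset2P => -[i' j' _ _ /set2_eq_cases[] []].
- by apply/imset2P; exists i j.
- by apply/imset2P; exists j i => //; rewrite finset.setUC.
- by apply/imset2P => -[i' j' _ _ /set2_eq_cases[] []].
Qed.

Lemma recolor_Forb (V X : finType) (B Y : rel X) (G : simple_graph V)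
    (f : V -> X) (t : nat) : symmetric B -> symmetric Y ->
  free_of_K2t B Y t -> Forb (complete_bipartite 2 t) (recolor B Y G f).
Proof.
move=> symB symY free [S [g [h gK hK] gadj]].
have hinj := can_inj hK.
have E u v : adj (complete_bipartite 2 t) u v =
    (h u != h v) && (B (f (val (h u))) (f (val (h v))) ||
      Y (f (val (h u))) (f (val (h v))) && adj G (val (h u)) (val (h v))).
  by rewrite -{1}(hK u) -{1}(hK v) gadj adj_induced adj_recolor.
pose a i := f (val (h (inl i))); pose b j := f (val (h (inr j))).
have ab i j : B (a i) (b j) || Y (a i) (b j).
  have := E (inl i) (inr j); rewrite adj_complete_bipartite /a /b.
  by move=> /esym/andP[_ /orP[->//|/andP[-> _]]]; rewrite orbT.
apply: (free (a ord0) (a ord_max) b) => //.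
  apply/negP => Ba; have := E (inl ord0) (inl ord_max).
  by rewrite adj_complete_bipartite (inj_eq hinj) -/(a _) -/(a _) Ba.
move=> i j ij; apply/negP => Bb; have := E (inr i) (inr j).
rewrite adj_complete_bipartite (inj_eq hinj) -/(b _) -/(b _) Bb andbT.
by move=> /esym/eqP[ijE]; rewrite ijE eqxx in ij.
Qed.

(** * Expected number of edits under a random map *)

Lemma card_ffun_at2 (V X : finType) (u v : V) (x y : X) : u != v ->
  #|[set f : {ffun V -> X} | (f u == x) && (f v == y)]| = #|X| ^ (#|V| - 2).
Proof.
move=> uv.
pose F w : pred X := if w == u then pred1 x else if w == v then pred1 y else predT.
rewrite (_ : #|_| = #|family F|); last first.
  apply: eq_card => f; rewrite inE; apply/andP/familyP => [[/eqP fu /eqP fv] w|H].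
    rewrite /F; case: eqP => [->|_]; first by rewrite inE fu.
    by case: eqP => [->|_]; rewrite inE ?fv.
  move: (H u) (H v); rewrite /F eqxx (eq_sym v) (negPf uv) eqxx.
  by rewrite !inE.
rewrite card_family /image_mem foldrE big_map big_enum /=.
rewrite (bigD1 u) //= (bigD1 v) 1?eq_sym //=.
rewrite /F eqxx (eq_sym v) (negPf uv) eqxx !card1 !mul1n.
under eq_bigr => w /andP[wu wv] do rewrite (negPf wu) (negPf wv).
rewrite prod_nat_const; congr (_ ^ _).
have -> : #|V| - 2 = #|~: [set u; v]| by rewrite cardsCs finset.setCK cards2 uv.
by apply: eq_card => w; rewrite !inE negb_or.
Qed.

(** For distinct [u] and [v] the pair [(f u, f v)] is uniformly distributed: every pair of values is
    taken by the same number of maps. *)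
Lemma card_ffun_rel (V X : finType) (P : rel X) (u v : V) : u != v ->
  #|[set f : {ffun V -> X} | P (f u) (f v)]| =
    #|[set z : X * X | P z.1 z.2]| * #|X| ^ (#|V| - 2).
Proof.
move=> uv; rewrite -sum1_card.
rewrite (partition_big (fun f : {ffun V -> X} => (f u, f v))
  (mem [set z : X * X | P z.1 z.2])) /=; last by move=> f; rewrite !inE.
rewrite -sum_nat_const; apply: eq_bigr => -[x y]; rewrite inE /= => Pxy.
rewrite -(card_ffun_at2 x y uv) -sum1_card; apply: eq_bigl => f.
rewrite !inE xpair_eqE; case: eqP => [->|_]; last by rewrite andbF.
by case: eqP => [->|_]; rewrite ?andbF // Pxy.
Qed.

Lemma card_edges_le (V : finType) (G : simple_graph V) :
  #|edges G| <= 'C(#|V|, 2).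
Proof.
rewrite -card_draws; apply: subset_leq_card; apply/fintype.subsetP => e eG.
by rewrite inE (forall_inP (valP G)).
Qed.

(** Double counting of maps and edited pairs; dividing by the number of maps bounds the expected
    number of edits. *)
Lemma sum_dist_recolor (V X : finType) (B Y : rel X) (G : simple_graph V) :
    symmetric B -> symmetric Y ->
  \sum_(f : {ffun V -> X}) dist G (recolor B Y G f) <=
    (#|edges G| * #|[set z : X * X | ~~ (B z.1 z.2 || Y z.1 z.2)]|
       + ('C(#|V|, 2) - #|edges G|) * #|[set z : X * X | B z.1 z.2]|)
    * #|X| ^ (#|V| - 2).
Proof.
move=> symB symY.
pose sd (f : {ffun V -> X}) :=
  (edges G :\: edges (recolor B Y G f)) :|: (edges (recolor B Y G f) :\: edges G).
pose N := #|X| ^ (#|V| - 2).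
pose cW := #|[set z : X * X | ~~ (B z.1 z.2 || Y z.1 z.2)]|.
pose cB := #|[set z : X * X | B z.1 z.2]|.
(* An edge is edited exactly when its image is white, a non-edge exactly when its image is black. *)
have mem_pair (f : {ffun V -> X}) u v : u != v ->
    ([set u; v] \in sd f) = if [set u; v] \in edges G
      then ~~ (B (f u) (f v) || Y (f u) (f v)) else B (f u) (f v).
  move=> uv; rewrite finset.in_setU !finset.in_setD -/(adj (recolor B Y G f) u v) adj_recolor // uv /=.
  by rewrite /adj; case: (_ \in edges G); rewrite ?andbT ?andbF ?orbF.
have card2 e (f : {ffun V -> X}) : e \in sd f -> #|e| == 2.
  by rewrite finset.in_setU !finset.in_setD => /orP[] /andP[_]; [move/(forall_inP (valP G))
    | move/(forall_inP (valP (recolor B Y G f)))].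
have count (e : {set V}) : #|e| == 2 ->
    \sum_(f : {ffun V -> X}) (e \in sd f : nat) =
      if e \in edges G then cW * N else cB * N.
  move=> /cards2P[u [v [uv ->]]]; under eq_bigr do rewrite mem_pair //.
  case: ifP => eG.
    have <- := card_ffun_rel (fun x y => ~~ (B x y || Y x y)) uv.
    rewrite -sum1_card [RHS]big_mkcond /=.
    by apply: eq_bigr => f _; rewrite inE; case: ifP.
  rewrite -(card_ffun_rel B uv) -sum1_card [RHS]big_mkcond /=.
  by apply: eq_bigr => f _; rewrite inE; case: ifP.
have -> : \sum_(f : {ffun V -> X}) dist G (recolor B Y G f) =
    \sum_(e : {set V} | #|e| == 2) \sum_(f : {ffun V -> X}) (e \in sd f : nat).
  rewrite exchange_big /=; apply: eq_bigr => f _.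
  rewrite /dist -/(sd f) -sum1_card big_mkcond [RHS]big_mkcond /=.
  by apply: eq_bigr => e _; case: ifP => [/card2->|]; rewrite ?if_same.
rewrite (eq_bigr _ count) (bigID (mem (edges G))) /=.
rewrite mulnDl -!mulnA; apply: leq_add.
  rewrite (eq_bigr (fun=> cW * N)) => [|e /andP[_ ->]//].
  rewrite sum_nat_const leq_mul2r; apply/orP; right; apply: subset_leq_card.
  by apply/fintype.subsetP => e /andP[].
rewrite (eq_bigr (fun=> cB * N)) => [|e /andP[_ /negPf->]//].
rewrite sum_nat_const leq_mul2r; apply/orP; right.
rewrite -card_draws -cardsDS; last first.
  by apply/fintype.subsetP => e eG; rewrite inE (forall_inP (valP G)).
by apply: subset_leq_card; apply/fintype.subsetP => e /andP[? ?]; rewrite !inE; apply/andP.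
Qed.

Lemma dist_to_le (P : graph_property) (V : finType) (G G' : simple_graph V) :
  P V G' -> (dist_to P G <= dist G G')%N.
Proof.
move=> PG'; rewrite /dist_to -minEnat -leEnat.
by apply: bigmin_le_cond; apply/asboolP.
Qed.

(** Every recoloring lies in the property, so the minimal distance is at most the average over all
    maps. *)
Lemma dist_to_Forb_le (V X : finType) (B Y : rel X) (G : simple_graph V)
    (t : nat) : symmetric B -> symmetric Y -> free_of_K2t B Y t ->
    1 < #|V| -> 0 < #|X| ->
  dist_to (Forb (complete_bipartite 2 t)) G * #|X| ^ 2 <=
    #|edges G| * #|[set z : X * X | ~~ (B z.1 z.2 || Y z.1 z.2)]|
    + ('C(#|V|, 2) - #|edges G|) * #|[set z : X * X | B z.1 z.2]|.
Proof.
move=> symB symY free V2 X0.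
have le := sum_dist_recolor G symB symY.
(* This factor turns [#|X| ^ 2] into the number of maps from [V] to [X]; [1 < #|V|] makes the
   truncated exponent exact. *)
rewrite -(@leq_pmul2r (#|X| ^ (#|V| - 2))) ?expn_gt0 ?X0 //.
apply: leq_trans le; rewrite -mulnA -expnD subnKC // mulnC -card_ffun -sum_nat_const.
apply: leq_sum => f _; apply: dist_to_le.
exact: recolor_Forb.
Qed.

(** * Roots of unity in a finite field *)

(** The nonzero elements are |F| - 1 roots of unity of that order, so one of them is primitive; its
    power by the cofactor of [s] has order [s]. *)
Lemma finField_prim_root (F : finFieldType) (s : nat) :
  s %| #|F|.-1 -> exists z : F, (s.-primitive_root z)%R.
Proof.
move=> sF; have F1 : 0 < #|F|.-1 by rewrite -subn1 subn_gt0 finNzRing_gt1.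
have /hasP[z _ zP] : has ((#|F|.-1).-primitive_root)%R [seq x <- enum F | x != 0%R].
  apply: has_prim_root => //; last 2 first.
  - by rewrite filter_uniq // enum_uniq.
  - rewrite -(cardC1 (0%R : F)) cardE.
    by apply: uniq_leq_size (enum_uniq _) _ => x; rewrite mem_enum mem_filter mem_enum andbT.
  apply/allP => x; rewrite mem_filter => /andP[x0 _]; rewrite unity_rootE.
  apply/eqP; apply: (mulfI x0).
  by rewrite mulr1 -exprS prednK ?expf_card // ltnW // finNzRing_gt1.
by exists (z ^+ (#|F|.-1 %/ s))%R; apply: dvdn_prim_root.
Qed.

Definition roots1 (F : finFieldType) (s : nat) : {set F} := [set h : F | h ^+ s == 1]%R.

Lemma card_roots1 (F : finFieldType) (s : nat) :
  s %| #|F|.-1 -> #|roots1 F s| = s.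
Proof.
move=> /finField_prim_root[z zP].
rewrite -[RHS]card_ord -(@card_imset _ _ (fun i : 'I_s => z ^+ i)%R); last first.
  move=> i j /eqP; rewrite (eq_prim_root_expr zP) !modn_small // => /eqP.
  exact: val_inj.
apply: eq_card => x; rewrite inE; apply/eqP/imsetP => [/(prim_rootP zP)[i ->]|[i _ ->]].
  by exists i.
by rewrite -exprM mulnC exprM (prim_expr_order zP) expr1n.
Qed.

Lemma roots1_neq0 (F : finFieldType) (s : nat) (h : F) :
  0 < s -> h \in roots1 F s -> h != 0%R.
Proof.
move=> s0; rewrite inE; apply: contraTneq => ->.
by rewrite expr0n eqn0Ngt s0 /= eq_sym oner_eq0.
Qed.

(** * The gray graph: orbits of vectors and dot products *)

Definition nzvec (F : finFieldType) := {v : F * F | v != (0, 0)%R}.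
HB.instance Definition _ (F : finFieldType) := Finite.on (nzvec F).

Definition dot (F : finFieldType) (a c : F * F) : F := (a.1 * c.1 + a.2 * c.2)%R.

Definition homothetic (F : finFieldType) (s : nat) (a c : F * F) : bool :=
  [exists h in roots1 F s, c == (h * a.1, h * a.2)%R].

(** Stands in for the quotient by H: vertices are mapped to single vectors, and the classes are
    those of this equivalence. All orbits have the same size, so a uniform vector gives a uniform
    class. *)
Definition same_block (F : finFieldType) (s : nat) : rel (bool * nzvec F) :=
  fun x y => (y.1 == x.1) && homothetic s (val x.2) (val y.2).

Definition dot_root1 (F : finFieldType) (s : nat) : rel (bool * nzvec F) :=
  fun x y => (y.1 == ~~ x.1) && (dot (val x.2) (val y.2) \in roots1 F s).

Lemma homothetic_sym (F : finFieldType) (s : nat) :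
  0 < s -> symmetric (@homothetic F s).
Proof.
move=> s0.
suff H a c : homothetic s a c -> @homothetic F s c a by move=> a c; apply/idP/idP; apply: H.
move=> /exists_inP[h hH /eqP->]; apply/exists_inP; exists (h^-1)%R.
  by move: hH; rewrite !inE exprVn => /eqP->; rewrite invr1.
by rewrite /= !mulKf ?(roots1_neq0 s0 hH) // -surjective_pairing.
Qed.

Lemma homothetic_trans (F : finFieldType) (s : nat) :
  transitive (@homothetic F s).
Proof.
move=> b a c /exists_inP[h hH /eqP->] /exists_inP[k kH /eqP->].
apply/exists_inP; exists (k * h)%R; last by rewrite /= !mulrA.
by move: hH kH; rewrite !inE exprMn => /eqP-> /eqP->; rewrite mulr1.
Qed.

Lemma same_block_sym (F : finFieldType) (s : nat) :
  0 < s -> symmetric (@same_block F s).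
Proof. by move=> s0 x y; rewrite /same_block homothetic_sym // eq_sym. Qed.

Lemma same_block_trans (F : finFieldType) (s : nat) :
  transitive (@same_block F s).
Proof.
move=> y x z /andP[/eqP e1 h1] /andP[/eqP e2 h2].
by rewrite /same_block e2 e1 eqxx (homothetic_trans h1 h2).
Qed.

Lemma dot_root1_sym (F : finFieldType) (s : nat) : symmetric (@dot_root1 F s).
Proof.
move=> x y; rewrite /dot_root1; congr andb; first by case: x.1; case: y.1.
by rewrite /dot mulrC [X in (_ + X)%R]mulrC.
Qed.

(** * Sizes of the black, gray and white relations *)

(** Projecting one copy to F^2 misses only the zero vector, which [Q] rejects. *)
Lemma card_block_row (F : finFieldType) (b : bool) (Q : pred (F * F)) :
  ~~ Q (0, 0)%R ->
  #|[set y : bool * nzvec F | (y.1 == b) && Q (val y.2)]| = #|[set w | Q w]|.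
Proof.
move=> Q0; rewrite -(@card_in_imset _ _ (fun y : bool * nzvec F => val y.2)).
  apply: eq_card => w; rewrite inE; apply/imsetP/idP => [[y]|Qw].
    by rewrite inE => /andP[_ ?] ->.
  have w0 : w != (0, 0)%R by apply: contraTneq Qw => ->.
  by exists (b, Sub w w0); rewrite ?inE ?eqxx ?SubK.
move=> [i v] [j w]; rewrite !inE /= => /andP[/eqP-> _] /andP[/eqP-> _] /val_inj->.
by [].
Qed.

Lemma card_homothetic (F : finFieldType) (s : nat) (a : F * F) :
  a != (0, 0)%R -> #|[set c | homothetic s a c]| = #|roots1 F s|.
Proof.
move=> a0; rewrite -(@card_imset _ _ (fun h => (h * a.1, h * a.2)%R)).
  apply: eq_card => c; rewrite inE; apply/exists_inP/imsetP.
    by case=> h hH /eqP->; exists h.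
  by case=> h hH ->; exists h.
move=> h k [e1 e2]; have [a10|/mulIf] := eqVneq a.1 0%R; last exact.
have [a20|/mulIf] := eqVneq a.2 0%R; last exact.
by move: a0; rewrite [a]surjective_pairing a10 a20 eqxx.
Qed.

(** [dot a] is a nonzero linear form: if one entry of [a] is nonzero, then [c] is determined by
    [dot a c] and its other coordinate, both arbitrary. *)
Lemma card_dot (F : finFieldType) (A : {set F}) (a : F * F) :
  a != (0, 0)%R -> #|[set c | dot a c \in A]| = #|F| * #|A|.
Proof.
move=> a0; rewrite mulnC -cardsT -cardsX.
have [a10|a10] := eqVneq a.1 0%R; last first.
  rewrite -[RHS](@card_imset _ _ (fun z : F * F => ((z.1 - a.2 * z.2) / a.1, z.2)%R)).
    apply: eq_card => c; rewrite inE; apply/idP/imsetP => [cA|[[h k]]].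
      exists (dot a c, c.2); first by rewrite !inE cA.
      rewrite /dot /= addrK mulrAC mulfV // mul1r.
      by rewrite -surjective_pairing.
    rewrite !inE andbT /= => hA ->.
    by rewrite /dot /= mulrCA mulfV // mulr1 subrK.
  move=> [h k] [h' k'] /= [/(mulIf (invr_neq0 a10)) e ek].
  by move: e; rewrite ek => /addIr ->.
have a20 : a.2 != 0%R.
  by apply: contraNneq a0 => a20; rewrite [a]surjective_pairing a10 a20 eqxx.
rewrite -[RHS](@card_imset _ _ (fun z : F * F => (z.2, z.1 / a.2)%R)).
  apply: eq_card => c; rewrite inE; apply/idP/imsetP => [cA|[[h k]]].
    exists (dot a c, c.1); first by rewrite !inE cA.
    rewrite /dot /= a10 mul0r add0r mulrAC mulfV // mul1r.
    by rewrite -surjective_pairing.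
  rewrite !inE andbT /= => hA ->.
  by rewrite /dot /= a10 mul0r add0r mulrCA mulfV // mulr1.
by move=> [h k] [h' k'] /= [-> /(mulIf (invr_neq0 a20)) ->].
Qed.

Lemma card_regular_rel (X : finType) (P : rel X) (d : nat) :
  (forall x, #|[set y | P x y]| = d) -> #|[set z : X * X | P z.1 z.2]| = #|X| * d.
Proof.
move=> Pd; rewrite -sum1_card.
rewrite (eq_bigl (fun z => true && P z.1 z.2)) => [|z]; last by rewrite inE.
rewrite -(pair_big_dep predT P (fun _ _ => 1)) /=.
rewrite -sum_nat_const; apply: eq_bigr => x _.
by rewrite sum1_card -(Pd x); apply: eq_card => y; rewrite !inE.
Qed.

Lemma card_same_block (F : finFieldType) (s : nat) : 0 < s -> s %| #|F|.-1 ->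
  #|[set z : (bool * nzvec F) * (bool * nzvec F) | same_block s z.1 z.2]|
    = #|{: bool * nzvec F}| * s.
Proof.
move=> s0 sF; apply: card_regular_rel => -[i a]; rewrite card_block_row /=.
  by rewrite card_homothetic ?(valP a) // card_roots1.
apply/exists_inP => -[h hH /eqP[/esym/eqP e1 /esym/eqP e2]].
move: e1 e2 (valP a); rewrite !mulf_eq0 (negPf (roots1_neq0 s0 hH)) /=.
by move=> /eqP e1 /eqP e2; rewrite [val a]surjective_pairing e1 e2 eqxx.
Qed.

Lemma card_dot_root1 (F : finFieldType) (s : nat) : 0 < s -> s %| #|F|.-1 ->
  #|[set z : (bool * nzvec F) * (bool * nzvec F) | dot_root1 s z.1 z.2]|
    = #|{: bool * nzvec F}| * (#|F| * s).
Proof.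
move=> s0 sF; apply: card_regular_rel => -[i a].
rewrite (@card_block_row _ _ [pred c | dot (val a) c \in roots1 F s]) /=.
  by rewrite card_dot ?(valP a) // card_roots1.
apply/negP => /(roots1_neq0 s0).
by rewrite /dot !mulr0 addr0 eqxx.
Qed.

Lemma card_signed_nzvec (F : finFieldType) :
  #|{: bool * nzvec F}| = 2 * (#|F| ^ 2).-1.
Proof.
rewrite card_prod card_bool card_sig; congr (_ * _).
by rewrite (cardC1 ((0, 0)%R : F * F)) card_prod.
Qed.

(** Black pairs stay in one copy and gray pairs switch copies, so the two relations are disjoint. *)
Lemma card_not_same_block_dot (F : finFieldType) (s : nat) : 0 < s -> s %| #|F|.-1 ->
  #|[set z : (bool * nzvec F) * (bool * nzvec F) |
       ~~ (same_block s z.1 z.2 || dot_root1 s z.1 z.2)]|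
    + #|{: bool * nzvec F}| * s + #|{: bool * nzvec F}| * (#|F| * s)
    = #|{: bool * nzvec F}| ^ 2.
Proof.
move=> s0 sF; rewrite -card_same_block // -card_dot_root1 // -addnA.
set A := [set z | same_block s z.1 z.2]; set D := [set z | dot_root1 s z.1 z.2].
have -> : #|A| + #|D| = #|A :|: D|.
  rewrite cardsU (_ : A :&: D = finset.set0) ?cards0 ?subn0 //.
  apply/setP => z; rewrite !inE /same_block /dot_root1.
  by case: z.2.1; case: z.1.1; rewrite ?andbF.
rewrite addnC (_ : [set z | ~~ _] = ~: (A :|: D)).
  by rewrite cardsC card_prod.
by apply/setP => z; rewrite !inE.
Qed.

(** * Absence of K_{2,t} in the gray graph *)

(** With l = (a.c') / (a.c) in H, the vector c' - l c is orthogonal to [a], and by the last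
    hypothesis to [a']. These two are independent, so c' = l c. *)
Lemma dot_pair_homothetic (F : finFieldType) (s : nat) (a a' c c' : F * F) :
    0 < s -> ~~ homothetic s a a' ->
    dot a c \in roots1 F s -> dot a c' \in roots1 F s ->
    dot a' c \in roots1 F s ->
    (dot a c * dot a' c' = dot a c' * dot a' c)%R ->
  homothetic s c c'.
Proof.
move=> s0 naa' ac ac' a'c e.
have ac0 := roots1_neq0 s0 ac.
have roots_div (h k : F) : h \in roots1 F s -> k \in roots1 F s -> (h / k)%R \in roots1 F s.
  by rewrite !inE exprMn exprVn => /eqP-> /eqP->; rewrite invr1 mulr1.
(* The determinant of [a] and [a']. If it vanished, [a'] would be [a] scaled by (a'.c) / (a.c),
   which lies in H. *)
pose D := (a.1 * a'.2 - a.2 * a'.1)%R.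
have D0 : D != 0%R.
  apply: contra naa' => /eqP D0; apply/exists_inP; exists (dot a' c / dot a c)%R.
    exact: roots_div.
  apply/eqP; rewrite [a']surjective_pairing /=; congr pair.
    apply: (mulIf ac0); rewrite mulrAC divfK //; apply/eqP; rewrite -subr_eq0.
    rewrite (_ : _ - _ = - (c.2 * D))%R; first by rewrite D0 mulr0 oppr0.
    by rewrite /D /dot /=; ring.
  apply: (mulIf ac0); rewrite mulrAC divfK //; apply/eqP; rewrite -subr_eq0.
  rewrite (_ : _ - _ = c.1 * D)%R; first by rewrite D0 mulr0.
  by rewrite /D /dot /=; ring.
apply/exists_inP; exists (dot a c' / dot a c)%R; first exact: roots_div.
apply/eqP; rewrite [c']surjective_pairing /=; congr pair.
  apply: (mulIf ac0); rewrite mulrAC divfK //; apply: (mulfI D0).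
  apply/eqP; rewrite -subr_eq0.
  rewrite (_ : _ - _ = - a.2 * (dot a c * dot a' c' - dot a c' * dot a' c))%R.
    by rewrite e subrr mulr0.
  by rewrite /D /dot /=; ring.
apply: (mulIf ac0); rewrite mulrAC divfK //; apply: (mulfI D0).
apply/eqP; rewrite -subr_eq0.
rewrite (_ : _ - _ = a.1 * (dot a c * dot a' c' - dot a c' * dot a' c))%R.
  by rewrite e subrr mulr0.
by rewrite /D /dot /=; ring.
Qed.

Lemma same_block_dot_free (F : finFieldType) (s t : nat) :
    0 < s -> s %| #|F|.-1 -> s < t -> 2 < t ->
  free_of_K2t (@same_block F s) (@dot_root1 F s) t.
Proof.
move=> s0 sF st t2 x x' y nxx' nyy xy x'y.
(* Gray pairs join opposite copies, so a [y j] in the copy of [z] lies in the class of [z]; two of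
   these would share a class. *)
have side z j : same_block s z (y j) || dot_root1 s z (y j) ->
    (y j).1 = z.1 -> same_block s z (y j).
  by move=> /orP[//|/andP[/eqP-> _]]; case: z.1.
have same_side z j k : (forall j, same_block s z (y j) || dot_root1 s z (y j)) ->
    j != k -> (y j).1 = z.1 -> (y k).1 = z.1 -> False.
  move=> zy jk jz kz; case/negP: (nyy _ _ jk).
  apply: (same_block_trans (y := z)); last exact: side.
  by rewrite same_block_sym // side.
have [exx'|nexx'] := eqVneq x.1 x'.1; last first.
  (* Two copies and [2 < t]: some two of the [y j] are in one copy, which is that of [x] or that of
     [x']. *)
  have /injectivePn[j [k jk ejk]] : ~~ injectiveb (fun j => (y j).1).
    apply/injectiveP => /leq_card; rewrite card_ord card_bool.
    by rewrite leqNgt t2.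
  have [jx|jx] := eqVneq (y j).1 x.1.
    by apply: (same_side x j k) => //; rewrite -ejk.
  have jx' : (y j).1 = x'.1 by move: jx nexx'; case: (y j).1; case: x.1; case: x'.1.
  by apply: (same_side x' j k) => //; rewrite -ejk.
(* A [y j] in the common copy of [x] and [x'] would put both into its class. *)
have other j : (y j).1 != x.1.
  apply/eqP => jx; case/negP: nxx'; apply: (same_block_trans (y := y j)).
    exact: side.
  by rewrite same_block_sym // side // -exx'.
have dots z j : (y j).1 != z.1 -> same_block s z (y j) || dot_root1 s z (y j) ->
    dot (val z.2) (val (y j).2) \in roots1 F s.
  by move=> /negPf jz /orP[|] /andP[]; rewrite ?jz.
have xyH j := dots x j (other j) (xy j).
have x'yH j : dot (val x'.2) (val (y j).2) \in roots1 F s.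
  by apply: dots => //; rewrite -exx'.
have nhom : ~~ homothetic s (val x.2) (val x'.2).
  by move: nxx'; rewrite /same_block exx' eqxx.
(* Equal ratios make two of the [y j] homothetic, so the ratios are [t] distinct elements of H,
   which has only [s]. *)
pose r j := (dot (val x.2) (val (y j).2) / dot (val x'.2) (val (y j).2))%R.
suff : #|'I_t| <= #|roots1 F s| by rewrite card_roots1 // card_ord leqNgt st.
have injr : injective r.
  move=> j k rjk; apply/eqP; apply: contraTT (xyH j) => jk.
  case/negP: (nyy _ _ jk); rewrite /same_block.
  have -> : (y k).1 = (y j).1.
    by move: (other j) (other k); case: (y j).1; case: (y k).1; case: x.1.
  rewrite eqxx; apply: (dot_pair_homothetic s0 nhom) => //.
  have x'j := roots1_neq0 s0 (x'yH j); have x'k := roots1_neq0 s0 (x'yH k).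
  by apply/eqP; rewrite -eqr_div //; apply/eqP.
rewrite -(card_imset _ injr); apply: subset_leq_card.
apply/fintype.subsetP => _ /imsetP[j _ ->].
move: (xyH j) (x'yH j); rewrite !inE exprMn exprVn => /eqP-> /eqP->.
by rewrite invr1 mulr1.
Qed.

(** * Upper bound on the edit distance function *)

Lemma edit_distance_le (R : realType) (P : graph_property) (p c : R) :
  (forall n, (max_dist P p n)%:R <= c * 'C(n, 2)%:R)%R ->
  (edit_distance P p <= c)%R.
Proof.
(* At [n = 2] the binomial coefficient is 1. *)
move=> H; have c0 : (0 <= c)%R by have := le_trans (ler0n R _) (H 2); rewrite mulr1.
rewrite /edit_distance.
have [cvgu|dvgu] := pselect (cvgn (fun n => (max_dist P p n)%:R / 'C(n, 2)%:R : R)%R).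
  apply: limr_le => //; apply: nearW => n.
  have [->|n0] := eqVneq 'C(n, 2) 0; first by rewrite invr0 mulr0.
  by rewrite ler_pdivrMr ?ltr0n ?lt0n.
(* No convergence is needed: [limn] of a divergent sequence is the default
   [point] of [R], which is [0]. *)
by rewrite (dvgP dvgu).
Qed.

Local Open Scope ring_scope.

(** Among the x = 2 (q^2 - 1) partners of a vector, s are black, q s gray and the rest white. With m
    edges the expected number of edits is at most (s C(n,2) + m (x - s (q + 2))) / x. *)
Lemma max_dist_Forb_K2t_le (R : realType) (F : finFieldType) (s t n : nat) (p : R) :
    (0 < s)%N -> (s %| #|F|.-1)%N -> (s < t)%N -> (2 < t)%N -> 0 <= p ->
  (max_dist (Forb (complete_bipartite 2 t)) p n)%:R <=
    (s%:R + p * (2 * (#|F|%:R ^+ 2 - 1) - s%:R * (#|F|%:R + 2)))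
      / (2 * (#|F|%:R ^+ 2 - 1)) * 'C(n, 2)%:R :> R.
Proof.
move=> s0 sF st t2 p0; set q := #|F|.
have q1 : (1 < q)%N := finNzRing_gt1 F.
have sq : (s < q)%N by rewrite -(prednK (ltnW q1)) ltnS dvdn_leq // -subn1 subn_gt0.
pose x : R := 2 * (q%:R ^+ 2 - 1).
have qR : s%:R + 1 <= q%:R :> R by rewrite natr1 ler_nat.
have s1 : 1 <= s%:R :> R by rewrite ler1n.
have x0 : 0 < x by rewrite /x; nra.
(* The coefficient of the edge count is nonnegative, so the count may be replaced by its upper bound
   p C(n,2). *)
have y0 : 0 <= x - s%:R * (q%:R + 2) by rewrite /x; nra.
rewrite -/x mulrAC ler_pdivlMr //.
have K0 : 0 <= (s%:R + p * (x - s%:R * (q%:R + 2))) * 'C(n, 2)%:R.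
  by rewrite mulr_ge0 // addr_ge0 // mulr_ge0.
rewrite /max_dist.
elim/big_ind: _ => [|a b ha hb|G eG]; first by rewrite mul0r.
  by rewrite /maxn; case: ifP.
(* Without pairs, the default ['C(n, 2)] of the minimum is already 0. *)
have [n1|n1] := leqP n 1.
  rewrite (_ : dist_to _ G = 0)%N ?mul0r //; apply/eqP; rewrite -leqn0.
  rewrite -[X in (_ <= X)%N](@bin_small n 2) // -[in X in (_ <= X)%N](card_ord n).
  by rewrite /dist_to -minEnat -leEnat; apply: bigmin_le_id.
have Xx : #|{: bool * nzvec F}|%:R = x.
  by rewrite card_signed_nzvec natrM -subn1 natrB ?natrX // expn_gt0 ltnW.
have /(_ 'I_n G) := @dist_to_Forb_le _ _ _ _ _ t (same_block_sym s0) (@dot_root1_sym F s)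
  (same_block_dot_free s0 sF st t2).
rewrite card_ord card_same_block // => /(_ n1).
have X0 : (0 < #|{: bool * nzvec F}|)%N by rewrite -(ltr0n R) Xx.
move=> /(_ X0); rewrite -(ler_nat R) natrM natrX Xx.
have := card_not_same_block_dot s0 sF; set W := #|[set z | ~~ _]|.
move=> /(congr1 (fun m => m%:R : R)); rewrite !natrD natrX !natrM Xx => WE.
have eN : (#|edges G| <= 'C(n, 2))%N by have := card_edges_le G; rewrite card_ord.
rewrite natrB // => le.
have ep : #|edges G|%:R <= p * 'C(n, 2)%:R :> R.
  by rewrite -[X in X <= _](_ : (#|edges G|%:Z)%:~R = _) // (eqP eG) floor_le.
rewrite -(ler_pM2l x0).
move: (dist_to _ G)%:R le => d le.
apply: (@le_trans _ _ (x * (s%:R * 'C(n, 2)%:R + #|edges G|%:R * (x - s%:R * (q%:R + 2))))).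
  move: le; rewrite -/q in WE *.
  have -> : W%:R = x ^+ 2 - x * s%:R - x * (q%:R * s%:R) by rewrite -WE; ring.
  lra.
rewrite ler_pM2l //.
have := ler_wpM2r y0 ep.
lra.
Qed.

(** * Prime powers congruent to 1 and the values p_q *)

Lemma prime_power_1mod (s N : nat) : (0 < s)%N ->
  exists q : nat, [/\ prime_power q, (N < q)%N & (s %| q - 1)%N].
Proof.
move=> s0; have [r rs rP] := prime_above s.
have cop : coprime r s.
  by rewrite prime_coprime //; apply: contraTN rs => /(dvdn_leq s0); rewrite ltnNge negbK.
have r1 := prime_gt1 rP.
(* Euler's theorem gives the congruence; the factor [N.+1] makes the power exceed [N]. *)
exists (r ^ (totient s * N.+1))%N; split.
- by exists r, (totient s * N.+1)%N; split => //; rewrite muln_gt0 totient_gt0 s0.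
- apply: leq_trans (ltn_expl _ r1) _; rewrite leq_exp2l //.
  by apply: leq_trans (leqnSn _) _; rewrite leq_pmull // totient_gt0.
- rewrite -eqn_mod_dvd ?expn_gt0 ?prime_gt0 // expnM.
  by rewrite -modnXm Euler_exp_totient // modnXm exp1n.
Qed.

(* The minimiser over p of the difference of the two sides of the inequality. *)
Definition edit_threshold (R : realType) (s q : nat) : R :=
  s%:R * (q%:R + 2) / (4 * (q%:R ^+ 2 - 1)).

(** The bound s / q, which amounts to q (q + 2) <= 4 (q^2 - 1), is what sends p_q to 0. *)
Lemma edit_threshold_bounds (R : realType) (s q : nat) :
  (0 < s)%N -> (s.+1 < q)%N ->
  [/\ 0 < edit_threshold R s q, edit_threshold R s q < 1
    & edit_threshold R s q <= s%:R / q%:R].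
Proof.
move=> s0 sq.
have s1 : 1 <= s%:R :> R by rewrite ler1n.
have qR : s%:R + 2 <= q%:R :> R by rewrite -natrD ler_nat addn2.
have x0 : 0 < 4 * (q%:R ^+ 2 - 1) :> R by nra.
have q0 : 0 < q%:R :> R by lra.
split.
- by rewrite /edit_threshold divr_gt0 // mulr_gt0 //; lra.
- by rewrite /edit_threshold ltr_pdivrMr // mul1r; nra.
rewrite /edit_threshold ler_pdivrMr // mulrAC ler_pdivlMr //.
rewrite -!mulrA ler_pM2l; last lra.
by nra.
Qed.

(** Since 4 (q^2 - 1) p = s (q + 2), the claim reduces to 2 < p (q + 2), that is 8 (q^2 - 1) < s (q
    + 2)^2. Here t >= 9 enters, as s >= 8. *)
Lemma edit_threshold_lt (R : realType) (s q : nat) (p := edit_threshold R s q) :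
  (8 <= s)%N -> (1 < q)%N ->
  (s%:R + p * (2 * (q%:R ^+ 2 - 1) - s%:R * (q%:R + 2)))
      / (2 * (q%:R ^+ 2 - 1)) < p * (1 - p).
Proof.
move=> s8 q1.
have s8R : 8 <= s%:R :> R by rewrite (ler_nat R 8).
have qR : 2 <= q%:R :> R by rewrite (ler_nat R 2).
have x0 : 0 < q%:R ^+ 2 - 1 :> R by nra.
rewrite ltr_pdivrMr ?mulr_gt0 //.
have pE : p * (4 * (q%:R ^+ 2 - 1)) = s%:R * (q%:R + 2).
  by rewrite /p /edit_threshold divfK // gt_eqF // mulr_gt0.
have p0 : 0 < p by rewrite /p /edit_threshold divr_gt0 ?mulr_gt0 //; lra.
have : 2 < p * (q%:R + 2).
  rewrite -(ltr_pM2r x0).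
  have e : 4 * (p * (q%:R + 2) * (q%:R ^+ 2 - 1)) = s%:R * (q%:R + 2) * (q%:R + 2).
    by rewrite -pE; ring.
  have : 8 * ((q%:R + 2) * (q%:R + 2)) <= s%:R * (q%:R + 2) * (q%:R + 2) :> R.
    by rewrite -[leRHS]mulrA ler_wpM2r // mulr_ge0 //; lra.
  by nra.
move=> p2.
have : s%:R * 2 < s%:R * (p * (q%:R + 2)) by rewrite ltr_pM2l //; lra.
have -> : s%:R * (p * (q%:R + 2)) = p * (p * (4 * (q%:R ^+ 2 - 1))) by rewrite pE; ring.
have -> : p * (2 * (q%:R ^+ 2 - 1) - s%:R * (q%:R + 2)) =
    p * (2 * (q%:R ^+ 2 - 1) - p * (4 * (q%:R ^+ 2 - 1))) by rewrite pE.
lra.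
Qed.

Local Open Scope classical_set_scope.
Local Open Scope ring_scope.

Theorem corollary9 (R : realType) (t : nat) (ht : (9 <= t)%N) :
  (exists (q0 : nat) (p : nat -> R),
     (forall q : nat, prime_power q -> (q0 < q)%N -> (t - 1 %| q - 1)%N ->
        0 < p q < 1 /\
        (t%:R - 1 + p q * (2 * q%:R ^+ 2 - q%:R * (t%:R - 1) - 2 * t%:R))
          / (2 * (q%:R ^+ 2 - 1)) < p q * (1 - p q)) /\
     p q @[q --> within [set q | prime_power q /\ (t - 1 %| q - 1)%N] \oo]
       --> (0 : R)) /\
  (forall eps : R, 0 < eps ->
     exists p : R, 0 < p < eps /\
       edit_distance (Forb (complete_bipartite 2 t)) p < p * (1 - p)).
Proof.
pose s := (t - 1)%N; rewrite -/s.
have tE : t = s.+1 by rewrite /s subn1 prednK // (leq_trans _ ht).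
have s8 : (8 <= s)%N by move: ht; rewrite tE.
have s0 : (0 < s)%N by apply: leq_trans s8.
split.
  exists t, (edit_threshold R s); split.
    move=> q _ tq _; have sq : (s.+1 < q)%N by rewrite -tE.
    have [p0 p1 _] := edit_threshold_bounds R s0 sq.
    have q1 : (1 < q)%N by apply: leq_trans sq.
    split; first by apply/andP.
    apply: le_lt_trans (edit_threshold_lt R s8 q1).
    (* The two left sides agree: 2 q^2 - q s - 2 (s + 1) = 2 (q^2 - 1) - s (q + 2). *)
    by rewrite tE -natr1 le_eqVlt; apply/orP; left; apply/eqP; congr (_ / _); ring.
  apply: cvg_within_filter.
  apply: (@squeeze_cvgr _ _ _ _ (fun=> 0) (fun q => s%:R / q%:R)).
  - near=> q; have sq : (s.+1 < q)%N by near: q; exact: nbhs_infty_gt.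
    by have [/ltW-> _ ->] := edit_threshold_bounds R s0 sq.
  - exact: cvg_cst.
  (* Shifting the index turns 1 / q into the harmonic sequence 1 / (n + 1). *)
  - rewrite -(cvg_shiftS (fun q => s%:R / q%:R : R)) /=.
    have H := @cvgMl_tmp R nat \oo _ harmonic s%:R 0 cvg_harmonic.
    by rewrite mulr0 in H; exact: H.
move=> eps eps0.
(* Any q > N has s / q < eps, hence p_q < eps. *)
have [N Ne] : exists N : nat, s%:R / eps < N%:R.
  by exists (Num.bound (s%:R / eps)); apply: archi_boundP; rewrite divr_ge0 // ltW.
have [q [[r [k [rP k0 qE]]] Nq sq1]] := prime_power_1mod (maxn s.+1 N) s0.
move: Nq; rewrite gtn_max => /andP[sq Nq].
have [p0 p1 ple] := edit_threshold_bounds R s0 sq.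
exists (edit_threshold R s q); split.
  rewrite p0 /=; apply: le_lt_trans ple _.
  have q0 : 0 < q%:R :> R by rewrite ltr0n (leq_trans _ sq).
  rewrite ltr_pdivrMr // mulrC -ltr_pdivrMr //.
  by apply: lt_trans Ne _; rewrite ltr_nat.
have [F _ cF] := pPrimePowerField rP k0.
rewrite -qE in cF.
have q1 : (1 < q)%N by apply: leq_trans sq.
apply: le_lt_trans (edit_threshold_lt R s8 q1).
apply: edit_distance_le => n.
rewrite -cF; apply: max_dist_Forb_K2t_le => //.
- by rewrite cF -subn1.
- by rewrite tE.
- by rewrite (leq_trans _ ht).
by rewrite cF ltW.
Unshelve. all: by end_near.
Qed.
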